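(* (Decomposition for Finite Commutative A-loops.) Let $Q$ be a finite commutative A-loop. Let $K(Q)=\{x\in Q : |x| \text{ is odd}\}$ and $H(Q)=\{x\in Q : x^{2^n}=1 \text{ for some integer } n\ge 0\}$. Then $K(Q)$ and $H(Q)$ are subloops and $Q = K(Q)\times H(Q)$ (internal direct product).
   Context: A loop is a set $Q$ with a binary operation and neutral element $1$ such that all left and right translations $L_x:y\mapsto xy$, $R_x:y\mapsto yx$ are bijections. $\mathrm{Mlt}(Q)$ is the group generated by all $L_x,R_x$, and $\mathrm{Inn}(Q)$ is the stabilizer of $1$ in it. A commutative A-loop is a commutative loop in which every element of $\mathrm{Inn}(Q)$ is an automorphism. Powers are defined by $x^n = 1L_x^n$ ($n\in\mathbb{Z}$); commutative A-loops are power-associative (each element generates a cyclic group), and $|x|$ denotes the order of $x$, i.e. the order of the cyclic subgroup generated by $x$. *)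

(* Defs.v *)
From HB Require Import structures.
From mathcomp Require Import all_boot all_fingroup.
Set Implicit Arguments. Unset Strict Implicit. Unset Printing Implicit Defensive.
Local Open Scope group_scope.

(* A finite loop: a finite set with a binary operation, neutral element,
   and all left/right translations bijective (on a finite type injectivity
   is equivalent to bijectivity). *)
Record finLoop := FinLoop {
  carrier :> finType;
  lmul : carrier -> carrier -> carrier;
  lone : carrier;
  lmul1x : forall x, lmul lone x = x;
  lmulx1 : forall x, lmul x lone = x;
  Linj : forall x, injective (lmul x);
  Rinj : forall x, injective (fun y => lmul y x)
}.

Section LoopDefs.
Variable Q : finLoop.

Definition Lp (x : Q) : {perm Q} := perm (@Linj Q x).
Definition Rp (x : Q) : {perm Q} := perm (@Rinj Q x).

Definition Mlt : {set {perm Q}} := << [set Lp x | x : Q] :|: [set Rp x | x : Q] >>.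
Definition Inn : {set {perm Q}} := [set p in Mlt | p (lone Q) == lone Q].

Definition loop_commutative := forall x y : Q, lmul x y = lmul y x.

Definition A_loop :=
  forall p, p \in Inn -> forall x y : Q, p (lmul x y) = lmul (p x) (p y).

Definition lpow (x : Q) (n : nat) : Q := (Lp x ^+ n) (lone Q).

(* |x| : the size of {1 L_x^n : n in Z} = the cyclic subgroup generated by x
   (for a permutation of a finite set, integer and natural powers give the
    same orbit). *)
Definition lorder (x : Q) : nat := #|porbit (Lp x) (lone Q)|.

Definition Kset (x : Q) : Prop := odd (lorder x).
Definition Hset (x : Q) : Prop := exists n : nat, lpow x (2 ^ n) = lone Q.

Definition is_subloop (S : Q -> Prop) :=
  [/\ S (lone Q),
      (forall x y, S x -> S y -> S (lmul x y)),
      (forall x y, S x -> S y -> S ((Lp x)^-1 y)) &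
      (forall x y, S x -> S y -> S ((Rp x)^-1 y))].

(* Q is the internal direct product A x B: the map (a,b) |-> ab from the
   direct product loop A x B to Q is a bijection and a homomorphism. *)
Definition internal_direct_product (A B : Q -> Prop) :=
  (forall x : Q, exists! ab : Q * Q, [/\ A ab.1, B ab.2 & x = lmul ab.1 ab.2]) /\
  (forall a1 a2 b1 b2 : Q, A a1 -> A a2 -> B b1 -> B b2 ->
     lmul (lmul a1 b1) (lmul a2 b2) = lmul (lmul a1 a2) (lmul b1 b2)).

End LoopDefs.

(* Main.v *)
Require Import Defs.
From mathcomp Require Import all_boot all_fingroup.
From mathcomp Require Import ssralg finmodule.

(** The automorphism [assoc_map x y = L_{xy}^-1 L_x L_y] fixes [x], which yields power-associativity and [(x y)^-1 = x^-1 y^-1].  As inner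
    mappings commute with inversion, the conjugates [j_x] of inversion by [L_x]
    satisfy [L_a j_x = j_{ax} L_a], so [j_x = j_y] is a congruence, and the
    class of [1] is [{x | x^2 = 1}].  Iterating, every [{x | x^(2^n) = 1}] is a
    normal subloop, and two elements of odd order that are congruent modulo it
    are equal.  Hence, for [k] of odd order and [h] of 2-power order, the odd
    part of [k h] is [k], so [k] and [h] are powers of [k h] and their
    translations commute; this gives [(k1 h1)(k2 h2) = (k1 k2)(h1 h2)].

    For [k1], [k2] of odd order, the 2-part [c(k1, k2)] of [k1 k2] is central,
    and [c] behaves like a 2-cocycle twisted by the automorphisms
    [assoc_map k1 k2].  Averaging over the set [K] of elements of odd order, as
    in the transfer, shows that an odd power of [c(k1, k2)] is [1]: inversion
    fixes only [1] in [K], so [#|K|] is odd.  Thus [c] is trivial and [K] is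
    closed. *)
Set Implicit Arguments. Unset Strict Implicit. Unset Printing Implicit Defensive.

(** * Parity and reindexing over finite sets *)

Lemma even_card_fixpoint_free (T : finType) (f : T -> T) (A : {set T}) :
  involutive f -> {in A, forall x, f x \in A} -> {in A, forall x, f x != x} ->
  ~~ odd #|A|.
Proof.
move=> fK; move: {2}#|A| (leqnn #|A|) => n; elim: n A => [|n IH] A leAn fA fx.
  by move: leAn; rewrite leqn0 => /eqP ->.
have [->|[x Ax]] := set_0Vmem A; first by rewrite cards0.
have Afx : f x \in A :\ x by rewrite !inE fx // fA.
rewrite (cardsD1 x) Ax (cardsD1 (f x)) Afx /= negbK.
apply: IH => [|y|y]; last by rewrite !inE => /and3P[_ _ /fx].
  by move: leAn; rewrite (cardsD1 x) Ax (cardsD1 (f x)) Afx !add1n => /ltnW.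
rewrite !inE => /and3P[yfx yx Ay]; rewrite fA // andbT.
by rewrite !(can2_eq fK fK) fK yx yfx.
Qed.

Lemma sum_reindex_inj (V : zmodType) (T : finType) (A : {set T}) (g : T -> T)
    (F : T -> V) :
  {in A, forall x, g x \in A} -> {in A &, injective g} ->
  (\sum_(x in A) F (g x) = \sum_(x in A) F x)%R.
Proof.
move=> gA injg; rewrite -big_imset //; apply: eq_bigl => x.
suff -> : [set g x | x in A] = A by [].
apply/eqP; rewrite eqEcard card_in_imset // leqnn andbT.
by apply/subsetP => _ /imsetP[y Ay ->]; apply: gA.
Qed.

Section CommutativeALoop.

Variable Q : finLoop.
Hypothesis mulC : loop_commutative Q.
Hypothesis Aut : A_loop Q.

Local Notation "x ** y" := (@lmul Q x y) (at level 40, left associativity).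
Local Notation one := (lone Q).

Implicit Types a c h k x y z : Q.

(** * Inverses and the inner automorphisms [assoc_map x y] *)

Definition ldiv (x y : Q) : Q := (Lp x)^-1%g y.
Definition linv (x : Q) : Q := ldiv x one.

Lemma LpE (x y : Q) : Lp x y = x ** y. Proof. exact: permE. Qed.

Lemma ldivK (x y : Q) : x ** ldiv x y = y.
Proof. by rewrite -LpE permKV. Qed.

Lemma Rp_Lp (x : Q) : Rp x = Lp x.
Proof. by apply/permP => y; rewrite !permE mulC. Qed.

Lemma mulxV (x : Q) : x ** linv x = one. Proof. exact: ldivK. Qed.

Lemma mulVx (x : Q) : linv x ** x = one. Proof. by rewrite mulC mulxV. Qed.

Lemma linv_unique (x y : Q) : x ** y = one -> y = linv x.
Proof. by move=> xy1; apply: (@Linj Q x); rewrite xy1 mulxV. Qed.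

Lemma linvK (x : Q) : linv (linv x) = x.
Proof. by symmetry; apply: linv_unique; rewrite mulVx. Qed.

Lemma linv1 : linv one = one.
Proof. by symmetry; apply: linv_unique; rewrite lmul1x. Qed.

Definition assoc_map (x y z : Q) : Q := ldiv (x ** y) (x ** (y ** z)).

Lemma assoc_mapE (x y z : Q) : (x ** y) ** assoc_map x y z = x ** (y ** z).
Proof. exact: ldivK. Qed.

Lemma assoc_mapM (x y u v : Q) :
  assoc_map x y (u ** v) = assoc_map x y u ** assoc_map x y v.
Proof.
(* Permutations compose from left to right: [p] applies [Lp y] first. *)
pose p : {perm Q} := (Lp y * Lp x * (Lp (x ** y))^-1)%g.
have pE z : p z = assoc_map x y z by rewrite /p !permM !LpE.
rewrite -!pE; apply: Aut; rewrite inE pE /assoc_map lmulx1.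
apply/andP; split; last first.
  by apply/eqP/(@Linj Q (x ** y)); rewrite ldivK lmulx1.
have LpM z : Lp z \in Mlt Q by apply: mem_gen; rewrite inE imset_f.
by rewrite /Mlt !groupM ?groupV //; apply: LpM.
Qed.

Lemma assoc_map_inj (x y : Q) : injective (assoc_map x y).
Proof.
move=> u v uv; apply: (@Linj Q y); apply: (@Linj Q x).
by rewrite -!assoc_mapE uv.
Qed.

Lemma assoc_map_fix (x y : Q) : assoc_map x y x = x.
Proof.
by apply: (@Linj Q (x ** y)); rewrite assoc_mapE (mulC y) mulC.
Qed.

Lemma assoc_map1 (x y : Q) : assoc_map x y one = one.
Proof. by apply: (@Linj Q (x ** y)); rewrite assoc_mapE !lmulx1. Qed.

Lemma assoc_mapV (x y z : Q) : assoc_map x y (linv z) = linv (assoc_map x y z).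
Proof. by apply: linv_unique; rewrite -assoc_mapM mulxV assoc_map1. Qed.

(** * Powers and orders *)

Lemma lpow0 (x : Q) : lpow x 0 = one.
Proof. by rewrite /lpow expg0 perm1. Qed.

Lemma lpowS (x : Q) (n : nat) : lpow x n.+1 = x ** lpow x n.
Proof. by rewrite /lpow expgSr permM permE. Qed.

Lemma lpow1 (x : Q) : lpow x 1 = x.
Proof. by rewrite lpowS lpow0 lmulx1. Qed.

Lemma lpow2 (x : Q) : lpow x 2 = x ** x.
Proof. by rewrite lpowS lpow1. Qed.

Lemma lpow1n (n : nat) : lpow one n = one.
Proof. by elim: n => [|n IH]; rewrite ?lpow0 // lpowS lmul1x. Qed.

Lemma assoc_mapX (x y z : Q) (n : nat) :
  assoc_map x y (lpow z n) = lpow (assoc_map x y z) n.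
Proof.
by elim: n => [|n IH]; rewrite ?lpow0 ?assoc_map1 // !lpowS assoc_mapM IH.
Qed.

Lemma lpow_mulCA1 (x y : Q) (n : nat) :
  x ** (lpow x n ** y) = lpow x n ** (x ** y).
Proof.
have fix_xn : assoc_map x y (lpow x n) = lpow x n.
  by rewrite assoc_mapX assoc_map_fix.
by rewrite [RHS]mulC -[in RHS]fix_xn assoc_mapE (mulC y).
Qed.

Lemma lpow_mulCA (x y : Q) (m n : nat) :
  lpow x m ** (lpow x n ** y) = lpow x n ** (lpow x m ** y).
Proof.
elim: n y => [|n IH] y; first by rewrite lpow0 !lmul1x.
(* [assoc_map x (lpow x n)] is an automorphism fixing the powers of [x], hence
   it commutes with multiplication by [lpow x m]. *)
have [z ->] : exists z, y = assoc_map x (lpow x n) z.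
  exists (ldiv (lpow x n) (ldiv x (lpow x n.+1 ** y))).
  by apply: (@Linj Q (x ** lpow x n)); rewrite assoc_mapE !ldivK lpowS.
have fix_xm : assoc_map x (lpow x n) (lpow x m) = lpow x m.
  by rewrite assoc_mapX assoc_map_fix.
rewrite -[in RHS]fix_xm -assoc_mapM lpowS !assoc_mapE.
by rewrite -IH !lpow_mulCA1.
Qed.

Lemma lpowD (x : Q) (m n : nat) : lpow x (m + n) = lpow x m ** lpow x n.
Proof.
elim: m => [|m IH]; first by rewrite lpow0 lmul1x.
by rewrite addSn !lpowS IH [RHS]mulC -lpow_mulCA1 [lpow x n ** _]mulC.
Qed.


Lemma lpowM (x : Q) (m n : nat) : lpow x (m * n) = lpow (lpow x m) n.
Proof.
by elim: n => [|n IH]; rewrite ?muln0 ?lpow0 // mulnS lpowD IH -lpowS.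
Qed.

Lemma lpow_order (x : Q) : lpow x (lorder x) = one.
Proof. by rewrite /lpow permX iter_porbit. Qed.

Lemma lpow_modn (x : Q) (m n : nat) :
  lpow x m = one -> lpow x n = lpow x (n %% m).
Proof.
by move=> xm; rewrite {1}(divn_eq n m) lpowD mulnC lpowM xm lpow1n lmul1x.
Qed.

Lemma lorder_gt0 (x : Q) : 0 < lorder x.
Proof. by apply/card_gt0P; exists one; rewrite porbit_id. Qed.

Lemma lorder_dvd (x : Q) (n : nat) : lpow x n = one -> lorder x %| n.
Proof.
rewrite (lpow_modn _ (lpow_order x)) /dvdn.
have := ltn_pmod n (lorder_gt0 x); move: (n %% _) => r ltr xr.
(* The first [lorder x] iterates of [Lp x] at [one] are distinct, so the remainder [r] must be 0. *)
have /uniqP uni := uniq_traject_porbit (Lp x) one.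
apply/eqP/(uni one); rewrite ?inE ?size_traject ?lorder_gt0 //.
by rewrite !nth_traject ?lorder_gt0 // -permX.
Qed.

Lemma KsetP (x : Q) : Kset x <-> exists2 n, odd n & lpow x n = one.
Proof.
split=> [odd_x|[n odd_n xn]].
  by exists (lorder x) => //; apply: lpow_order.
exact: dvdn_odd (lorder_dvd xn) odd_n.
Qed.

Lemma linv_lpow (x : Q) : linv x = lpow x (lorder x).-1.
Proof.
symmetry; apply: linv_unique.
by rewrite -lpowS prednK ?lorder_gt0 // lpow_order.
Qed.

(** * Inversion and the congruences [sim n] *)

Lemma linvM (x y : Q) : linv (x ** y) = linv x ** linv y.
Proof.
(* With [z = (x y)^-1], the automorphism [f = assoc_map z x] fixes [z]; it maps
   [y] to the inverse of [z x] and [x^-1] to [(z x) \ z]. *)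
pose z := linv (x ** y); pose f := assoc_map z x.
have fy : f y = linv (z ** x).
  by apply: linv_unique; rewrite assoc_mapE mulVx.
have fyV : f (linv y) = z ** x by rewrite /f assoc_mapV -/f fy linvK.
apply: (@assoc_map_inj z x); rewrite assoc_map_fix assoc_mapM -/f fyV mulC.
by rewrite assoc_mapE mulxV lmulx1.
Qed.

(* The conjugate of inversion by the left translation by [x]. *)
Definition symm (x z : Q) : Q := x ** linv (ldiv x z).

Lemma symmM (a x z : Q) : symm (a ** x) (a ** z) = a ** symm x z.
Proof.
rewrite /symm -{1}(ldivK x z) -/(assoc_map _ _ _) -assoc_mapV.
exact: assoc_mapE.
Qed.

(* [sim n] is the congruence whose class of [1] is [{x | x^(2^n) = 1}]. *)
Fixpoint sim (n : nat) (x y : Q) : Prop :=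
  if n is n'.+1 then forall z, sim n' (symm x z) (symm y z) else x = y.

Lemma sim_sym n x y : sim n x y -> sim n y x.
Proof. by elim: n x y => //= n IH x y xy z; apply: IH. Qed.

Lemma sim_trans n x y z : sim n x y -> sim n y z -> sim n x z.
Proof.
elim: n x y z => /= [|n IH] x y z; first by move=> ->.
by move=> xy yz t; apply: IH (xy t) (yz t).
Qed.

Lemma simMl n a x y : sim n x y -> sim n (a ** x) (a ** y).
Proof.
elim: n a x y => /= [|n IH] a x y; first by move=> ->.
by move=> xy z; rewrite -(ldivK a z) !symmM; apply: IH.
Qed.

Lemma simMlI n a x y : sim n (a ** x) (a ** y) -> sim n x y.
Proof.
elim: n a x y => /= [|n IH] a x y; first exact: Linj.
by move=> xy z; apply: (IH a); rewrite -!symmM.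
Qed.

(** At [z = one] the relation compares x^2 with 1. Conversely, x^2 ~ 1 = x x^-1 cancels to x ~ x^-1;
    for z = x u this gives z^-1 = x^-1 u^-1 ~ x u^-1, which is [symm x z]. *)
Lemma sim1S n x : sim n.+1 x one <-> sim n (lpow x 2) one.
Proof.
rewrite lpow2; split=> [/(_ one)|xx z].
  by rewrite /symm -!/(linv _) linvK !linv1 lmulx1.
have /(simMlI) xV : sim n (x ** x) (x ** linv x) by rewrite mulxV.
rewrite /symm lmul1x; have -> : ldiv one z = z by rewrite -[LHS]lmul1x ldivK.
rewrite -{2}(ldivK x z) linvM ![_ ** linv (ldiv _ _)]mulC.
exact: simMl.
Qed.

Lemma sim1P n x : sim n x one <-> lpow x (2 ^ n) = one.
Proof.
elim: n x => [|n IH] x; first by rewrite lpow1.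
by apply: iff_trans (sim1S _ _) _; rewrite expnS lpowM; apply: IH.
Qed.

(** The quotient [ldiv x y] reduces the claim to the class of [one], described by [sim1P]. *)
Lemma sim_monotone m n x y : m <= n -> sim m x y -> sim n x y.
Proof.
move=> /subnKC <- xy.
have /simMlI/sim_sym/sim1P d1 : sim m (x ** one) (x ** ldiv x y).
  by rewrite lmulx1 ldivK.
rewrite -(lmulx1 x) -[X in sim _ _ X](ldivK x y).
apply: simMl; apply: sim_sym; apply/sim1P.
by rewrite expnD lpowM d1 lpow1n.
Qed.

(** * The subloop of elements of 2-power order *)

Lemma HsetP x : Hset x <-> exists n, sim n x one.
Proof. by split=> -[n xn]; exists n; apply/sim1P. Qed.

Lemma HsetM x y : Hset x -> Hset y -> Hset (x ** y).
Proof.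
move=> /HsetP[m xm] /HsetP[n yn]; apply/HsetP; exists (maxn m n).
apply: sim_trans (sim_monotone (leq_maxl _ _) xm).
rewrite -[X in sim _ _ X]lmulx1; apply: simMl.
exact: sim_monotone (leq_maxr _ _) yn.
Qed.

Lemma Hset_ldiv x y : Hset x -> Hset y -> Hset (ldiv x y).
Proof.
move=> /HsetP[m xm] /HsetP[n yn]; apply/HsetP; exists (maxn m n).
apply: (@simMlI _ x); rewrite ldivK lmulx1.
apply: sim_trans (sim_monotone (leq_maxr _ _) yn) _.
exact/sim_sym/(sim_monotone (leq_maxl _ _) xm).
Qed.

Lemma Hset1 : Hset one. Proof. by exists 0; rewrite lpow1n. Qed.

(** * Elements of odd order and the splitting of an element *)

Lemma Kset1 : Kset one. Proof. by apply/KsetP; exists 1; rewrite ?lpow1n. Qed.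

Lemma KsetX x n : Kset x -> Kset (lpow x n).
Proof.
move=> /KsetP[m om xm]; apply/KsetP; exists m => //.
by rewrite -lpowM mulnC lpowM xm lpow1n.
Qed.

Lemma sqr_Kset_inj x y : Kset x -> Kset y -> lpow x 2 = lpow y 2 -> x = y.
Proof.
move=> /KsetP[m om xm] /KsetP[n on yn] xy.
(* For odd N, z^N = 1 gives z = (z^2)^((N+1)/2); N = [m * n] serves both [x] and [y]. *)
have rt z : lpow z (m * n) = one -> z = lpow (lpow z 2) (m * n).+1./2.
  move=> zmn; rewrite -lpowM mul2n even_halfK /= ?oddM ?om ?on //.
  by rewrite lpowS zmn lmulx1.
rewrite (rt x) 1?(rt y) ?xy //; first by rewrite mulnC lpowM yn lpow1n.
by rewrite lpowM xm lpow1n.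
Qed.

(** At [one], [sim n.+1] relates the squares by [sim n], and squaring is injective on odd order. *)
Lemma sim_Kset n x y : Kset x -> Kset y -> sim n x y -> x = y.
Proof.
elim: n x y => //= n IH x y Kx Ky /(_ one).
rewrite /symm -!/(linv _) !linvK -!lpow2 => xy.
by apply: sqr_Kset_inj => //; apply: IH xy; apply: KsetX.
Qed.

Lemma Kset_Hset_eq1 x : Kset x -> Hset x -> x = one.
Proof. by move=> Kx /HsetP[n xn]; apply: sim_Kset Kset1 xn. Qed.

(** The exponent is 0 modulo the 2-part of the order and 1 modulo its odd part; [even_exp] swaps
    these. *)
Definition odd_exp (x : Q) : nat :=
  chinese (lorder x)`_2 (lorder x)`_2^' 0 1.
Definition even_exp (x : Q) : nat :=
  chinese (lorder x)`_2 (lorder x)`_2^' 1 0.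
Definition odd_part (x : Q) : Q := lpow x (odd_exp x).
Definition even_part (x : Q) : Q := lpow x (even_exp x).

Lemma odd_part_even_part x : odd_part x ** even_part x = x.
Proof.
have cop := coprime_partC 2 (lorder x) (lorder x).
have eqn := partnC 2 (lorder_gt0 x).
rewrite /odd_part /even_part -lpowD -[RHS]lpow1.
rewrite (lpow_modn _ (lpow_order x)) [RHS](lpow_modn _ (lpow_order x)).
congr lpow; apply/eqP; rewrite -[X in _ %% X]eqn -[X in _ == _ %% X]eqn.
rewrite chinese_remainder //; apply/andP.
by split; rewrite -modnDm !(chinese_modl cop, chinese_modr cop) modnDm.
Qed.

Lemma odd_part_Kset x : Kset (odd_part x).
Proof.
apply/KsetP; exists (lorder x)`_2^'.
  by rewrite odd_2'nat part_pnat.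
rewrite -lpowM; have /dvdnP[q ->] : lorder x %| odd_exp x * (lorder x)`_2^'.
  rewrite -{1}(partnC 2 (lorder_gt0 x)) dvdn_mul // /dvdn chinese_modl ?mod0n //.
  exact: coprime_partC.
by rewrite mulnC lpowM lpow_order lpow1n.
Qed.

Lemma even_part_Hset x : Hset (even_part x).
Proof.
exists (logn 2 (lorder x)); rewrite -p_part -lpowM.
have /dvdnP[q ->] : lorder x %| even_exp x * (lorder x)`_2.
  rewrite -{1}(partnC 2 (lorder_gt0 x)) mulnC dvdn_mul // /dvdn.
  by rewrite chinese_modr ?mod0n // coprime_partC.
by rewrite mulnC lpowM lpow_order lpow1n.
Qed.

Lemma Kset_Hset_unique k k' h h' : Kset k -> Kset k' -> Hset h -> Hset h' ->
  k ** h = k' ** h' -> k = k' /\ h = h'.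
Proof.
move=> Kk Kk' /HsetP[m hm] /HsetP[n hn] e.
suff ek : k = k' by split=> //; apply: (@Linj Q k); rewrite e ek.
apply: (@sim_Kset (maxn m n)) => //.
apply: (@sim_trans _ _ (k ** h)).
  rewrite -{1}[k]lmulx1; apply/simMl/sim_sym/(sim_monotone _ hm).
  exact: leq_maxl.
rewrite e -{2}[k']lmulx1; apply/simMl/(sim_monotone _ hn).
exact: leq_maxr.
Qed.

Lemma parts_mul k h : Kset k -> Hset h ->
  odd_part (k ** h) = k /\ even_part (k ** h) = h.
Proof.
move=> Kk Hh; apply: Kset_Hset_unique => //.
- exact: odd_part_Kset.
- exact: even_part_Hset.
- exact: odd_part_even_part.
Qed.

(** * Associativity between odd and 2-power order *)

Lemma Kset_Hset_mulCA k h y : Kset k -> Hset h -> k ** (h ** y) = h ** (k ** y).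
Proof.
move=> Kk Hh; have [ek eh] := parts_mul Kk Hh.
have := lpow_mulCA (k ** h) y (odd_exp (k ** h)) (even_exp (k ** h)).
by rewrite -/(odd_part _) -/(even_part _) ek eh.
Qed.

Lemma mulKKH k1 k2 h : Kset k1 -> Kset k2 -> Hset h ->
  (k1 ** k2) ** h = k1 ** (k2 ** h).
Proof. by move=> K1 K2 Hh; rewrite [LHS]mulC -Kset_Hset_mulCA // (mulC h). Qed.

Lemma mulHHK h1 h2 k : Hset h1 -> Hset h2 -> Kset k ->
  (h1 ** h2) ** k = h1 ** (h2 ** k).
Proof. by move=> H1 H2 Kk; rewrite [LHS]mulC Kset_Hset_mulCA // (mulC k). Qed.

(** The automorphism [assoc_map k h] fixes both parts of [y], hence [y]. *)
Lemma mulKH_assoc k h y : Kset k -> Hset h -> (k ** h) ** y = k ** (h ** y).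
Proof.
move=> Kk Hh; suff {1}<- : assoc_map k h y = y by rewrite assoc_mapE.
rewrite -(odd_part_even_part y) assoc_mapM.
have := odd_part_Kset y; have := even_part_Hset y.
move: (odd_part y) (even_part y) => k' h' Hh' Kk'.
congr (_ ** _); apply: (@Linj Q (k ** h)); rewrite assoc_mapE.
  by rewrite Kset_Hset_mulCA // [LHS]mulC (mulC k) mulKKH // mulC.
by rewrite [RHS]mulC (mulC k h) -(mulHHK Hh' Hh Kk) [RHS]mulC (mulC h').
Qed.

Lemma mulKH k1 k2 h1 h2 : Kset k1 -> Kset k2 -> Hset h1 -> Hset h2 ->
  (k1 ** h1) ** (k2 ** h2) = (k1 ** k2) ** (h1 ** h2).
Proof.
move=> K1 K2 H1 H2; rewrite mulKH_assoc // -(@Kset_Hset_mulCA k2) //.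
by rewrite mulKKH //; apply: HsetM.
Qed.

(** * The centre and the 2-part of a product *)

(** By commutativity this one law implies the other nuclear laws. *)
Definition loop_center : {set Q} :=
  [set c | [forall x, forall y, c ** (x ** y) == (c ** x) ** y]].

Lemma centerP c :
  reflect (forall x y, c ** (x ** y) = (c ** x) ** y) (c \in loop_center).
Proof.
rewrite inE; apply: (iffP forallP) => [cP x y | cP x].
  by have /forallP/(_ y)/eqP := cP x.
by apply/forallP => y; rewrite cP.
Qed.

(** Closure of odd order under products is still open, so products are projected back; [defect] is
    the error. *)
Definition kmul (x y : Q) : Q := odd_part (x ** y).
Definition defect (x y : Q) : Q := even_part (x ** y).

Lemma kmul_defect x y : kmul x y ** defect x y = x ** y.
Proof. exact: odd_part_even_part. Qed.

Lemma kmul_Kset x y : Kset (kmul x y). Proof. exact: odd_part_Kset. Qed.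

Lemma defect_Hset x y : Hset (defect x y). Proof. exact: even_part_Hset. Qed.

Lemma kmul_inj y k k' : Kset y -> Kset k -> Kset k' ->
  kmul y k = kmul y k' -> k = k'.
Proof.
move=> Ky Kk Kk' ekk'; pose d := ldiv (defect y k') (defect y k).
have Hd : Hset d by apply: Hset_ldiv; apply: defect_Hset.
have e : k ** one = k' ** d.
  apply: (@Linj Q y); rewrite lmulx1 -mulKKH // -(kmul_defect y k').
  rewrite mulKH_assoc ?ldivK -?ekk' ?kmul_defect //; first exact: kmul_Kset.
  exact: defect_Hset.
by have [] := Kset_Hset_unique Kk Kk' Hset1 Hd e.
Qed.

Lemma defect_center x y : Kset x -> Kset y -> defect x y \in loop_center.
Proof.
move=> Kx Ky; have Kk := kmul_Kset x y; have Hc := defect_Hset x y.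
have := kmul_defect x y; move: (kmul x y) (defect x y) Kk Hc => k c Kk Hc kc.
(* After multiplication by [k], the product [k c = x y] lets the mixed rules apply; the odd parts of
   [u] and [v] are pulled out afterwards. *)
have cHH h h' : Hset h -> Hset h' -> c ** (h ** h') = (c ** h) ** h'.
  move=> Hh Hh'; apply: (@Linj Q k); rewrite -mulKH_assoc // kc.
  rewrite mulKKH //; last exact: HsetM.
  rewrite (mulC h) (Kset_Hset_mulCA h) // (Kset_Hset_mulCA _ Kx) //.
  by rewrite -(mulKKH Kx Ky) // -kc mulKH_assoc // -Kset_Hset_mulCA // (mulC h').
apply/centerP => u v; rewrite -(odd_part_even_part u) -(odd_part_even_part v).
have := (odd_part_Kset u, even_part_Hset u).
have := (odd_part_Kset v, even_part_Hset v).
move: (odd_part u) (even_part u) (odd_part v) (even_part v) => k1 h1 k2 h2.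
move=> [K2 H2] [K1 H1].
have Hch : Hset (c ** h1) by apply: HsetM.
rewrite mulKH_assoc // -!(@Kset_Hset_mulCA k1) // mulKH_assoc //.
congr (_ ** _); rewrite -!(@Kset_Hset_mulCA k2) // cHH //.
Qed.

Lemma Kset_assoc_map x y k : Kset k -> Kset (assoc_map x y k).
Proof.
move=> /KsetP[n on kn]; apply/KsetP; exists n => //.
by rewrite -assoc_mapX kn assoc_map1.
Qed.

(** The twisted cocycle identity: compare the 2-parts of both sides of [assoc_mapE x y k]. *)
Lemma defect_assoc x y k : Kset x -> Kset y -> Kset k ->
  defect x (kmul y k) ** defect y k
    = defect (kmul x y) (assoc_map x y k) ** defect x y.
Proof.
move=> Kx Ky Kk; have Kt := Kset_assoc_map x y Kk.
have [Kxy Hxy] := (kmul_Kset x y, defect_Hset x y).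
have [Kyk Hyk] := (kmul_Kset y k, defect_Hset y k).
have := assoc_mapE x y k.
rewrite -{1}(kmul_defect x y) -(kmul_defect y k) -mulKKH //.
have mulD u v w : (u ** v) ** w = kmul u v ** (defect u v ** w).
  by rewrite -mulKH_assoc ?kmul_defect //; [apply: kmul_Kset | apply: defect_Hset].
rewrite (mulKH_assoc _ Kxy) // (mulC (defect x y)) -mulKKH // !mulD.
have HD u v w : Hset w -> Hset (defect u v ** w).
  by move=> Hw; apply: HsetM Hw; apply: defect_Hset.
move=> /(Kset_Hset_unique (kmul_Kset _ _) (kmul_Kset _ _) (HD _ _ _ Hxy)).
by move=> /(_ (HD _ _ _ Hyk)) [].
Qed.

(** * The transfer argument *)

Lemma Lp_center c x : c \in loop_center -> Lp (c ** x) = (Lp x * Lp c)%g.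
Proof. by move=> /centerP cP; apply/permP => y; rewrite permM !LpE cP. Qed.

(** Central elements become translations in an abelian permutation group, so that [fmod] allows
    additive sums. *)
Definition center_mlt := <<[set Lp c | c in loop_center]>>%G.

Lemma center_mlt_abelian : abelian center_mlt.
Proof.
rewrite abelian_gen; apply/centsP => _ /imsetP[c Zc ->] _ /imsetP[d Zd ->].
by rewrite /commute -!Lp_center // mulC.
Qed.

Lemma Lp_center_mlt c : c \in loop_center -> Lp c \in center_mlt.
Proof. by move=> Zc; apply: mem_gen; apply: imset_f. Qed.

Definition Kfin : {set Q} := [set x | odd (lorder x)].

Lemma in_Kfin x : Kset x <-> x \in Kfin. Proof. by rewrite inE. Qed.

Local Open Scope ring_scope.
Import GRing.Theory FiniteModule.

Local Notation fm c := (fmod center_mlt_abelian (Lp c)).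

(* The transfer: summing [defect_assoc] over [k] splits [defect], up to the odd
   factor [#|Kfin|]. *)
Definition transfer_defect (x : Q) := \sum_(k in Kfin) fm (defect x k).


Lemma transfer_defectD x y : Kset x -> Kset y ->
  transfer_defect x + transfer_defect y
    = transfer_defect (kmul x y) + fm (defect x y) *+ #|Kfin|.
Proof.
move=> Kx Ky; rewrite /transfer_defect.
(* Reindexing by [kmul y] on the left and by [assoc_map x y] on the right makes the sums match
   [defect_assoc] termwise. *)
rewrite -(@sum_reindex_inj _ _ _ (kmul y) (fun k => fm (defect x k))); first last.
- by move=> k k' /in_Kfin Kk /in_Kfin Kk'; apply: kmul_inj.
- by move=> k _; apply/in_Kfin/kmul_Kset.
rewrite -[in RHS](@sum_reindex_inj _ _ _ (assoc_map x y)); first last.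
- by move=> k k' _ _; apply: assoc_map_inj.
- by move=> k /in_Kfin Kk; apply/in_Kfin/Kset_assoc_map.
rewrite -sumr_const -!big_split; apply: eq_bigr => k /in_Kfin Kk /=.
have Kt := Kset_assoc_map x y Kk.
have Kyk := kmul_Kset y k; have Kxy := kmul_Kset x y.
rewrite -!fmodM ?Lp_center_mlt ?defect_center // -!Lp_center ?defect_center //.
by rewrite mulC [in RHS]mulC defect_assoc // mulC.
Qed.

Lemma defect_lpow x m n : Kset x -> defect (lpow x m) (lpow x n) = one.
Proof.
move=> Kx; rewrite /defect -lpowD -[lpow _ _]lmulx1.
by have [_] := parts_mul (KsetX (m + n) Kx) Hset1.
Qed.

Lemma kmul_lpow x m n : Kset x -> kmul (lpow x m) (lpow x n) = lpow x (m + n).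
Proof.
move=> Kx; rewrite /kmul -lpowD -[in LHS](lmulx1 (lpow _ _)).
by have [] := parts_mul (KsetX (m + n) Kx) Hset1.
Qed.

Lemma fm1 : fm one = 0.
Proof.
have -> : Lp one = 1%g by apply/permP => x; rewrite LpE lmul1x perm1.
exact: fmod1.
Qed.

Lemma transfer_defect1 : transfer_defect one = 0.
Proof.
apply: big1 => k /in_Kfin Kk.
by rewrite -(lpow0 k) -{2}(lpow1 k) defect_lpow // fm1.
Qed.

Lemma transfer_defectX x n : Kset x ->
  transfer_defect (lpow x n) = transfer_defect x *+ n.
Proof.
move=> Kx; elim: n => [|n IH]; first by rewrite lpow0 transfer_defect1.
have := transfer_defectD (KsetX 1 Kx) (KsetX n Kx).
by rewrite defect_lpow // kmul_lpow // fm1 mul0rn addr0 lpow1 IH mulrS => <-.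
Qed.

Lemma odd_card_Kfin : odd #|Kfin|.
Proof.
have K1 : one \in Kfin by apply/in_Kfin/Kset1.
rewrite (cardsD1 one) K1 /=; apply: (@even_card_fixpoint_free _ linv).
- exact: linvK.
- move=> x; rewrite !in_setD1 => /andP[x1 /in_Kfin Kx].
  apply/andP; split; last by apply/in_Kfin; rewrite linv_lpow; apply: KsetX.
  by apply: contra_neq x1 => xV; rewrite -(linvK x) xV linv1.
- move=> x; rewrite in_setD1 => /andP[x1 /in_Kfin Kx].
  apply: contra_neq x1 => xV; apply: sqr_Kset_inj => //; first exact: Kset1.
  by rewrite lpow1n lpow2 -{2}xV mulxV.
Qed.

(** All three transfer values in [transfer_defectD] have odd torsion and [#|Kfin|] is odd, so the
    defect has both odd and 2-power order. *)
Lemma defect_eq1 x y : Kset x -> Kset y -> defect x y = one.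
Proof.
move=> Kx Ky; apply: Kset_Hset_eq1; last exact: defect_Hset.
have torsion z : Kset z -> exists2 n, odd n & transfer_defect z *+ n = 0.
  move=> Kz; have [n on zn] := (KsetP z).1 Kz; exists n => //.
  by rewrite -transfer_defectX // zn transfer_defect1.
have [a oa xa] := torsion x Kx; have [b ob yb] := torsion y Ky.
have [c oc xyc] := torsion _ (kmul_Kset x y).
apply/KsetP; exists (#|Kfin| * (a * b * c))%N.
  by rewrite !oddM odd_card_Kfin oa ob oc.
have Zd := defect_center Kx Ky.
have /eqP : fm (defect x y) *+ (#|Kfin| * (a * b * c)) = 0.
  rewrite mulrnA; set e := (a * b * c)%N.
  have -> : fm (defect x y) *+ #|Kfin| =
      transfer_defect x + transfer_defect y - transfer_defect (kmul x y).
    by rewrite transfer_defectD // addrC addKr.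
  rewrite mulrnBl mulrnDl /e -!mulnA mulrnA xa mul0rn.
  rewrite mulnCA mulrnA yb mul0rn !mulnA mulnC mulrnA xyc mul0rn.
  by rewrite addr0 subr0.
rewrite -fmodX ?Lp_center_mlt // => /eqP/congr_fmod.
rewrite fmval0 fmodK ?groupX ?Lp_center_mlt // => d1.
by rewrite /lpow d1 perm1.
Qed.

(** * The subloop of elements of odd order *)

Lemma KsetM x y : Kset x -> Kset y -> Kset (x ** y).
Proof.
move=> Kx Ky; rewrite -kmul_defect defect_eq1 // lmulx1; exact: kmul_Kset.
Qed.

Lemma Kset_ldiv x y : Kset x -> Kset y -> Kset (ldiv x y).
Proof.
move=> Kx Ky; set d := ldiv x y.
have [Kd Hd] := (odd_part_Kset d, even_part_Hset d).
have e : (x ** odd_part d) ** even_part d = y ** one.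
  by rewrite mulKKH // odd_part_even_part ldivK lmulx1.
have [_ d1] := Kset_Hset_unique (KsetM Kx Kd) Ky Hd Hset1 e.
by rewrite -(odd_part_even_part d) d1 lmulx1.
Qed.

End CommutativeALoop.

Theorem theorem5p1 (Q : finLoop) :
  loop_commutative Q -> A_loop Q ->
  [/\ is_subloop (@Kset Q), is_subloop (@Hset Q) &
      internal_direct_product (@Kset Q) (@Hset Q)].
Proof.
move=> mulC Aut; split.
- split; [exact: Kset1 | exact: KsetM | exact: Kset_ldiv |].
  by move=> x y; rewrite Rp_Lp //; apply: Kset_ldiv.
- split; [exact: Hset1 | exact: HsetM | exact: Hset_ldiv |].
  by move=> x y; rewrite Rp_Lp //; apply: Hset_ldiv.
split=> [x | k1 k2 h1 h2 K1 K2 H1 H2]; last exact: mulKH.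
exists (odd_part x, even_part x); split.
  split; [exact: odd_part_Kset | exact: even_part_Hset |].
  by rewrite /= odd_part_even_part.
move=> [k h] [/= Kk Hh ->].
by have [-> ->] := parts_mul mulC Aut Kk Hh.
Qed.
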